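(* Let $a=\sum_{n\in\mathbb{Z},\,n\equiv1\pmod 3}x^{n^2}\in\mathbb{Z}/2[[x]]$ and let $B(a)$ be the set of integers $n$ such that the coefficient of $x^n$ in the Laurent series $1/a$ is $1$. If $n\equiv 0\pmod 2$ and $n\in B(a)$, then $n/2$ is a perfect square.
   Context: $1/a$ is computed in the field of Laurent series over $\mathbb{Z}/2$. *)

(* Defs.v *)
From HB Require Import structures.
From mathcomp Require Import all_boot all_order all_algebra.
From mathcomp Require Import boolp classical_sets functions cardinality fsbigop.
From mathcomp Require Import zify ring.

Set Implicit Arguments.
Unset Strict Implicit.
Unset Printing Implicit Defensive.

Import Order.TTheory GRing.Theory Num.Theory.
Local Open Scope ring_scope.
Local Open Scope classical_set_scope.

(** The field F((x)) of formal Laurent series over a field F.  A series is its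
    coefficient function Z -> F, which vanishes below some integer. *)

Record laurent (F : fieldType) := Laurent {
  lcoef : int -> F;
  lcoef_bounded : exists v : int, forall n : int, n < v -> lcoef n = 0
}.

HB.instance Definition _ (F : fieldType) := gen_eqMixin (laurent F).
HB.instance Definition _ (F : fieldType) := gen_choiceMixin (laurent F).

Section Laurent.
Variable F : fieldType.
Implicit Types (f g h : laurent F) (p q : {poly F}) (u c : nat -> F) (v w : int).

Lemma laurentP f g : lcoef f =1 lcoef g -> f = g.
Proof.
case: f g => [f Hf] [g Hg] /= /funext E.
by case: g / E Hg => Hg; congr Laurent; exact: Prop_irrelevance.
Qed.

Lemma laurent_at_subproof v u :
  exists w, forall n, n < w -> (if v <= n then u `|n - v|%N else 0) = 0.
Proof. by exists v => n nv; rewrite leNgt nv. Qed.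

(** x^v * \sum_(k >= 0) u_k x^k; for v = 0 this is the inclusion of F[[x]]. *)
Definition laurent_at v u : laurent F := Laurent (laurent_at_subproof v u).

Lemma lzero_subproof : exists w : int, forall n : int, n < w -> (0 : F) = 0.
Proof. by exists 0. Qed.
Definition lzero : laurent F := Laurent lzero_subproof.

Lemma lopp_subproof f : exists w, forall n, n < w -> - lcoef f n = 0.
Proof. by have [v Hv] := lcoef_bounded f; exists v => n /Hv ->; rewrite oppr0. Qed.
Definition lopp f : laurent F := Laurent (lopp_subproof f).

Lemma ladd_subproof f g : exists w, forall n, n < w -> lcoef f n + lcoef g n = 0.
Proof.
have [v Hv] := lcoef_bounded f; have [w Hw] := lcoef_bounded g.
exists (Num.min v w) => n; rewrite lt_min => /andP[nv nw].
by rewrite Hv // Hw // addr0.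
Qed.
Definition ladd f g : laurent F := Laurent (ladd_subproof f g).

Lemma laddA : associative ladd.
Proof. by move=> f g h; apply/laurentP => n /=; rewrite addrA. Qed.
Lemma laddC : commutative ladd.
Proof. by move=> f g; apply/laurentP => n /=; rewrite addrC. Qed.
Lemma ladd0 : left_id lzero ladd.
Proof. by move=> f; apply/laurentP => n /=; rewrite add0r. Qed.
Lemma laddN : left_inverse lzero lopp ladd.
Proof. by move=> f; apply/laurentP => n /=; rewrite addNr. Qed.

HB.instance Definition _ :=
  GRing.isZmodule.Build (laurent F) laddA laddC ladd0 laddN.

(** The sum has finite support because f and g are bounded below. *)
Lemma lmul_subproof f g : exists w, forall n, n < w ->
  \sum_(i \in [set: int]) lcoef f i * lcoef g (n - i) = 0.
Proof.
have [v Hv] := lcoef_bounded f; have [w Hw] := lcoef_bounded g.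
exists (v + w) => n nvw; apply: fsbig1 => i _.
have [/Hv ->|vi] := ltP i v; first by rewrite mul0r.
by rewrite Hw ?mulr0 //; lia.
Qed.
Definition lmul f g : laurent F := Laurent (lmul_subproof f g).

Definition lone : laurent F := laurent_at 0 (fun k => (k == 0%N)%:R).

(** f = x^v * (p + O(x^N)) *)
Let rep f v p N := (forall n, n < v -> lcoef f n = 0) /\
  (forall k, (k < N)%N -> lcoef f (v + k%:Z) = p`_k).

Let rep_ext f g : (exists v, forall N, exists p, rep f v p N /\ rep g v p N) ->
  f = g.
Proof.
move=> [v H]; apply/laurentP => n.
have [p [[f0 fp] [g0 gp]]] := H `|n - v|.+1%N.
have [nv|vn] := ltP n v; first by rewrite f0 // g0.
have -> : n = v + `|n - v|%N%:Z by lia.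
by rewrite fp // gp.
Qed.

Let rep_bound f v N : (forall n, n < v -> lcoef f n = 0) ->
  rep f v (\poly_(k < N) lcoef f (v + k%:Z)) N.
Proof. by move=> H; split=> // k kN; rewrite coef_poly kN. Qed.

Let rep_at v u N : rep (laurent_at v u) v (\poly_(k < N) u k) N.
Proof.
split=> [n nv|k kN] /=; first by rewrite leNgt nv.
rewrite coef_poly kN (_ : v <= _); last by lia.
by congr u; lia.
Qed.

Let rep_add f g v p q N : rep f v p N -> rep g v q N -> rep (ladd f g) v (p + q) N.
Proof.
move=> [f0 fp] [g0 gp]; split=> [n nv|k kN] /=; first by rewrite f0 // g0 // addr0.
by rewrite fp // gp // coefD.
Qed.

Let rep_mul f g v w p q N :
  rep f v p N -> rep g w q N -> rep (lmul f g) (v + w) (p * q) N.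
Proof.
move=> [f0 fp] [g0 gp]; split=> [n nvw|k kN] /=.
  apply: fsbig1 => i _; have [/f0 ->|vi] := ltP i v; first by rewrite mul0r.
  by rewrite g0 ?mulr0 //; lia.
rewrite (fsbigE [seq v + j%:Z | j <- iota 0 k.+1]); first last.
- move=> i _ ni; have [/f0 ->|vi] := ltP i v; first by rewrite mul0r.
  rewrite g0 ?mulr0 //; rewrite ltNge; apply: contra ni => ni.
  apply/mapP; exists `|i - v|%N; last by lia.
  by rewrite mem_iota; lia.
- by [].
- by rewrite map_inj_uniq ?iota_uniq // => i j; lia.
rewrite big_map coefM -(big_mkord xpredT (fun j => p`_j * q`_(k - j))) /=.
rewrite /index_iota subn0 big_seq_cond [RHS]big_seq_cond.
apply: eq_big => [i|i /andP[]]; first by rewrite in_setT.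
rewrite -[_ \in _]/(i \in iota 0 k.+1) mem_iota => ik _; rewrite fp; last by lia.
congr (_ * _); rewrite -gp; last by lia.
by congr lcoef; lia.
Qed.

Let rep_one N : rep lone 0 1 N.
Proof.
split=> [n n0|k kN] /=; first by rewrite leNgt n0.
by rewrite coef1 addn0.
Qed.

Lemma lmulC : commutative lmul.
Proof.
move=> f g; have [v Hv] := lcoef_bounded f; have [w Hw] := lcoef_bounded g.
apply: rep_ext; exists (v + w) => N; eexists; split.
  by apply: rep_mul; apply: rep_bound.
by rewrite addrC mulrC; apply: rep_mul; apply: rep_bound.
Qed.

Lemma lmulA : associative lmul.
Proof.
move=> f g h; have [v Hv] := lcoef_bounded f; have [w Hw] := lcoef_bounded g.
have [x Hx] := lcoef_bounded h.
apply: rep_ext; exists (v + (w + x)) => N; eexists; split.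
  by apply: rep_mul; [|apply: rep_mul]; apply: rep_bound.
by rewrite addrA mulrA; apply: rep_mul; [apply: rep_mul|]; apply: rep_bound.
Qed.

Lemma lmul1 : left_id lone lmul.
Proof.
move=> f; have [v Hv] := lcoef_bounded f.
apply: rep_ext; exists v => N; eexists; split; last exact: rep_bound.
rewrite -[v in rep _ v]add0r -[X in rep _ _ X]mul1r.
by apply: rep_mul; [apply: rep_one|apply: rep_bound].
Qed.

Lemma lmulDl : left_distributive lmul ladd.
Proof.
move=> f g h; have [v Hv] := lcoef_bounded f; have [w Hw] := lcoef_bounded g.
have [x Hx] := lcoef_bounded h; pose m := Num.min v w.
have Hfm n : n < m -> lcoef f n = 0 by rewrite lt_min => /andP[/Hv].
have Hgm n : n < m -> lcoef g n = 0 by rewrite lt_min => /andP[_ /Hw].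
apply: rep_ext; exists (m + x) => N; eexists; split.
  by apply: rep_mul; [apply: rep_add|]; apply: rep_bound.
by rewrite mulrDl; apply: rep_add; apply: rep_mul; apply: rep_bound.
Qed.

Lemma lone_neq0 : lone != 0.
Proof.
apply/eqP => /(congr1 (fun f => lcoef f 0)) /= /eqP.
by rewrite oner_eq0.
Qed.

HB.instance Definition _ := GRing.Zmodule_isComNzRing.Build (laurent F)
  lmulA lmulC lmul1 lmulDl lone_neq0.

Let series_inv c : c 0%N != 0 ->
  exists u, forall k, \sum_(i < k.+1) c i * u (k - i)%N = (k == 0%N)%:R.
Proof.
move=> c0.
pose fix s n : seq F := if n is m.+1 then rcons (s m)
  (((m == 0%N)%:R - \sum_(i < m) c i.+1 * (s m)`_(m - i.+1)) / c 0%N) else [::].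
have ss n : size (s n) = n by elim: n => //= n IH; rewrite size_rcons IH.
pose u n := (s n.+1)`_n.
have su n k : (k < n)%N -> (s n)`_k = u k.
  elim: n => // n IH kn; rewrite /= nth_rcons ss.
  have [/IH //|nk] := ltnP k n; have <- : k = n by lia.
  by rewrite eqxx /u /= nth_rcons ss ltnn eqxx.
exists u => k; rewrite big_ord_recl /= subn0 {1}/u /= nth_rcons ss ltnn eqxx.
rewrite mulrC divfK // [X in _ - X + _](eq_bigr
  (fun i : 'I_k => c i.+1 * u (k - i.+1)%N)) ?subrK // => i _.
by rewrite su //; have := ltn_ord i; lia.
Qed.

Lemma linv_exists f : f != 0 -> exists g, f * g = 1.
Proof.
move=> f0; have [v Hv] := lcoef_bounded f.
have exk : exists k : nat, lcoef f (v + k%:Z) != 0.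
  apply: contrapT => H; move/eqP: f0; apply; apply/laurentP => n /=.
  have [/Hv //|vn] := ltP n v; apply/eqP; apply: contrapT => /negP fn.
  by apply: H; exists `|n - v|%N; have -> : v + `|n - v|%N%:Z = n by lia.
case: (ex_minnP exk) => m fm mmin; pose w := v + m%:Z.
have Hw n : n < w -> lcoef f n = 0.
  rewrite /w => nw; have [/Hv //|vn] := ltP n v.
  apply/eqP; apply: contrapT => /negP fn.
  have := mmin `|n - v|%N; have -> : v + `|n - v|%N%:Z = n by lia.
  by move=> /(_ fn); lia.
have [|u Hu] := @series_inv (fun k => lcoef f (w + k%:Z)); first by rewrite addr0.
exists (laurent_at (- w) u); apply: rep_ext; exists 0 => N; exists 1.
split; last exact: rep_one.
have [H0 Hk] := rep_mul (rep_bound N Hw) (rep_at (- w) u N).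
rewrite subrr in H0 Hk; split=> // k kN; rewrite Hk // coefM coef1 -Hu.
apply: eq_bigr => i _; have ik := ltn_ord i.
by rewrite !coef_poly !ifT //; lia.
Qed.

Definition linv f : laurent F := xget 0 [set g | f * g = 1].

Lemma lmulVf f : f != 0 -> linv f * f = 1.
Proof. by move=> /linv_exists H; rewrite mulrC; exact: (xgetPex 0 H). Qed.

Lemma linv0 : linv 0 = 0.
Proof.
rewrite /linv; case: xgetP => // g _ /= /eqP.
by rewrite mul0r eq_sym oner_eq0.
Qed.

HB.instance Definition _ := GRing.ComNzRing_isField.Build (laurent F) lmulVf linv0.

End Laurent.

(** a = \sum_(n in Z, n = 1 mod 3) x^(n^2): the coefficient of x^k sums, over
    all n = 1 mod 3, the coefficient of x^k in x^(n^2); only finitely many n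
    contribute. *)
Definition a : laurent 'F_2 := laurent_at 0 (fun k : nat =>
  \sum_(n \in [set n : int | (n = 1 %[mod 3])%Z]) ((n ^+ 2 == k%:Z)%:R : 'F_2)).

Definition B (f : laurent 'F_2) : set int := [set n | lcoef (1 / f) n = 1].

Lemma a_neq0 : a != 0.
Proof.
apply/eqP => /(congr1 (fun f => lcoef f 1)) /=.
rewrite (fsbigE [:: 1 : int]) //=.
- by rewrite big_cons big_nil mem_set.
- by move=> n /=; rewrite inE => /eqP ->.
- move=> n /= n1; rewrite inE => nn1; case: eqP => // n2; exfalso.
  have /eqP : n ^+ 2 = 1 by rewrite n2.
  rewrite sqrf_eq1 (negbTE nn1) => /eqP nN1.
  by rewrite nN1 in n1.
Qed.

(* Main.v *)
Require Import Defs.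
From mathcomp Require Import all_boot all_order all_algebra.
From mathcomp Require Import classical_sets.
From mathcomp Require Import boolp functions cardinality fsbigop.
From mathcomp Require Import zify.
Import Order.TTheory GRing.Theory Num.Theory.
Local Open Scope ring_scope.
Local Open Scope classical_set_scope.

(** Let E be the operator that extracts the even-indexed coefficients:
    E(f)_n = f_(2n).  Over F_2, g^2 = g(x^2), so E(f g^2) = E(f) g.  An even n = 1 mod 3 is -2 m with m = 1 mod 3, so the even part of
    a is a(x^4), that is E(a) = a^2.  Since 1/a = a (1/a)^2, this gives
    E(1/a) = a^2 (1/a) = a, whose exponents are squares. *)

(** The terms at [i] and [c - i] are equal, so in characteristic 2 they cancel in pairs and only the
    fixed points of the reflection survive. *)
Lemma fsbig_reflect (R : nzRingType) (A : set int) (u : int -> R) (c : int) :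
  2 \in [pchar R] -> finite_set A -> (forall i, A i -> A (c - i)) ->
  (forall i, u (c - i) = u i) ->
  \sum_(i \in A) u i = \sum_(i \in A `&` [set i | i = c - i]) u i.
Proof.
move=> ch2 Afin Ac uc; rewrite (fsbigID [set i | i = c - i]) //=.
rewrite [X in _ + X](_ : _ = 0) ?addr0 //.
rewrite (fsbigID [set i | (i < c - i)%R]) /=; last exact: finite_setIl.
(* The reflection maps the half [i < c - i] of the non-fixed points onto the half [i > c - i], so
   the two halves have the same sum; 0 is written as that sum taken twice. *)
rewrite -[RHS](addrr_pchar2 ch2
  (\sum_(i \in A `&` ~` [set i | i = c - i] `&` [set i | (i < c - i)%R]) u i)).
congr (_ + _).
rewrite [LHS](@reindex_fsbig _ _ _ _ _ (fun i => c - i)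
  (A `&` ~` [set i | i = c - i] `&` [set i | (i < c - i)%R])).
  by apply: eq_fsbigr => i _; rewrite uc.
split=> [i [[Ai /= ne] lt]|i j _ _|i [[Ai /= ne] /negP lt]] /=.
- by split; [split; [exact: Ac|lia]|apply/negP; lia].
- by lia.
- by exists (c - i); [split; [split; [exact: Ac|move=> /=; lia]|move=> /=; lia]|lia].
Qed.

Lemma finite_set_int_segment (v w : int) :
  finite_set [set i : int | (v <= i)%R && (i <= w)%R].
Proof.
apply: (@sub_finite_set _ _ [set` [seq v + k%:Z | k <- iota 0 `|w - v|%N.+1]]).
  move=> i /andP[vi iw]; apply/mapP; exists `|i - v|%N; last by lia.
  by rewrite mem_iota; lia.
exact: finite_seq.
Qed.

Section Char2.
Variable F : fieldType.
Hypothesis ch2 : 2 \in [pchar F].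
Implicit Types (f g : laurent F) (n : int).

Lemma lcoef_sqr f n :
  lcoef (f * f) n = \sum_(i \in [set i | i = n - i]) lcoef f i ^+ 2.
Proof.
have [v Hv] := lcoef_bounded f.
(* Both factors can be nonzero only in this window, which is finite and stable under
   [i -> n - i]. *)
pose A := [set i : int | (v <= i)%R && (i <= n - v)%R].
have out i : ~ A i -> lcoef f i * lcoef f (n - i) = 0.
  move=> /negP; rewrite negb_and -!ltNge => /orP[/Hv ->|h]; first by rewrite mul0r.
  by rewrite (Hv (n - i)) ?mulr0 //; lia.
transitivity (\sum_(i \in A) lcoef f i * lcoef f (n - i)).
  by symmetry; apply: fsbig_widen => // i [_]; exact: out.
rewrite (fsbig_reflect _ _ _ n) //; first last.
- by move=> i; rewrite mulrC; congr (lcoef f _ * _); lia.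
- by move=> i; rewrite /A /=; lia.
- exact: finite_set_int_segment.
transitivity (\sum_(i \in [set i | i = n - i]) lcoef f i * lcoef f (n - i)).
  apply: fsbig_widen => [i []//|i [/= ini nAi]]; apply: out => Ai.
  exact: nAi.
by apply: eq_fsbigr => i; rewrite inE /= => <-; rewrite expr2.
Qed.

Lemma lcoef_sqr_even f n : lcoef (f * f) (2 * n) = lcoef f n ^+ 2.
Proof.
rewrite lcoef_sqr -[RHS](fsbig_set1 +%R n (fun i => lcoef f i ^+ 2)).
by apply: eq_fsbigl; apply/seteqP; split=> i /=; lia.
Qed.

Lemma lcoef_sqr_odd f n : lcoef (f * f) (2 * n + 1) = 0.
Proof. by rewrite lcoef_sqr; apply: fsbig1 => i /=; lia. Qed.

(** Since [f * f] is a series in x^2, only the even indices [i = 2 * j] contribute to the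
    convolution. Over F_2 this reads E(f^2 g) = f E(g). *)
Lemma lcoef_sqr_mul_even f g n :
  lcoef (f * f * g) (2 * n) =
  \sum_(i \in [set: int]) lcoef f i ^+ 2 * lcoef g (2 * (n - i)).
Proof.
pose u i := lcoef (f * f) i * lcoef g (2 * n - i).
transitivity (\sum_(i \in [set 2 * j | j in [set: int]]) u i).
  symmetry; apply: fsbig_widen => // i [_ odd_i] /=.
  have [i2|i2] := boolP (2 %| i)%Z.
    by exfalso; apply: odd_i; exists (i %/ 2)%Z => //; lia.
  by rewrite /u (_ : i = 2 * (i %/ 2)%Z + 1) ?lcoef_sqr_odd ?mul0r //; lia.
rewrite fsbig_image; last by move=> i j _ _; lia.
by apply: eq_fsbigr => i _; rewrite /u lcoef_sqr_even mulrBr.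
Qed.

End Char2.

Lemma sqrF2 (x : 'F_2) : x ^+ 2 = x.
Proof. by apply/eqP; case: x => -[|[|]]. Qed.

Lemma pchar_F2 : 2 \in [pchar 'F_2].
Proof. exact: pchar_Fp. Qed.

(** Negative [k] may be included because no square is negative. *)
Lemma lcoef_a (k : int) : lcoef a k =
  \sum_(n \in [set n : int | (n = 1 %[mod 3])%Z]) ((n ^+ 2 == k)%:R : 'F_2).
Proof.
rewrite /=; case: ifP => k0.
  by apply: eq_fsbigr => n _; congr ((_ == _)%:R); lia.
by symmetry; apply: fsbig1 => n _; case: eqP => // e; exfalso; nia.
Qed.

Lemma lcoef_a_double (k : int) : lcoef a (2 * k) = lcoef (a * a) k.
Proof.
have [k2|k2] := boolP (2 %| k)%Z; last first.
  (* For odd [k] both sides vanish: a^2 has no term of odd degree, and [2 * k] is 2 mod 4, hence not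
     a square. *)
  rewrite (_ : k = 2 * (k %/ 2)%Z + 1) ?(lcoef_sqr_odd _ pchar_F2); last by lia.
  rewrite lcoef_a; apply: fsbig1 => n _; case: eqP => // e; exfalso.
  have [n2|n2] := boolP (2 %| n)%Z.
    by have := divzK n2; move: (n %/ 2)%Z e => m e nE; subst n; lia.
  have nE : n = 2 * (n %/ 2)%Z + 1 by lia.
  by move: nE e; move: (n %/ 2)%Z => m ->; lia.
have := divzK k2; move: (k %/ 2)%Z => j <-; rewrite [j * 2]mulrC.
rewrite (lcoef_sqr_even _ pchar_F2) sqrF2 !lcoef_a.
(* Now [k = 2 * j]. A root of n^2 = 4j is even, so [n = -2 * m] with [m] again 1 mod 3, and the
   equation becomes m^2 = j. *)
transitivity (\sum_(n \in [set -2 * m | m in [set m : int | (m = 1 %[mod 3])%Z]])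
    ((n ^+ 2 == 2 * (2 * j))%:R : 'F_2)).
  symmetry; apply: fsbig_widen => [_ [m /= m1 <-]|n [/= n1 nIm]] /=; first by lia.
  case: eqP => // e; exfalso; apply: nIm.
  have [n2|n2] := boolP (2 %| n)%Z.
    by exists (- (n %/ 2)%Z) => /=; lia.
  have nE : n = 2 * (n %/ 2)%Z + 1 by lia.
  by move: nE e; move: (n %/ 2)%Z => m ->; lia.
rewrite fsbig_image; last by move=> m m' _ _; lia.
by apply: eq_fsbigr => m _; congr (_%:R); apply/eqP/eqP; lia.
Qed.

Lemma lcoef_inv_a_double (k : int) : lcoef a^-1 (2 * k) = lcoef a k.
Proof.
(* The left side becomes E(a^-1 a^-1 a), and the right side is then expanded as a^-1 (a a), so that
   the two convolutions agree term by term. *)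
rewrite -[in LHS](mulfK a_neq0 a^-1) mulrAC.
rewrite (lcoef_sqr_mul_even _ pchar_F2) -[in RHS](mulKf a_neq0 a).
by apply: eq_fsbigr => i _; rewrite sqrF2 lcoef_a_double.
Qed.

Theorem theorem2p4 (n : int) :
  (n = 0 %[mod 2])%Z -> n \in B a -> exists m : int, (n %/ 2)%Z = m ^+ 2.
Proof.
move=> n0; rewrite inE => nB.
have {}nB : lcoef a (n %/ 2)%Z = 1.
  by rewrite -lcoef_inv_a_double -div1r -nB; congr lcoef; lia.
apply: contrapT => nsq; have /eqP := oner_neq0 'F_2; apply; rewrite -nB lcoef_a.
by apply: fsbig1 => m _; case: eqP => // e; exfalso; apply: nsq; exists m.
Qed.
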